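(* Let $\mathfrak{g}$ be a nonzero complex Lie algebra and let $\mathfrak{n}$ be a Lie subalgebra of $\mathfrak{g}$. If $\mathfrak{n}$ is finite dimensional, then $\mathfrak{W}^{\mathfrak{g}}_{\mathfrak{n}}$ is a Serre subcategory of the category $\mathfrak{g}\text{-}\mathrm{Mod}$ of all $\mathfrak{g}$-modules (that is, for every short exact sequence $0\to X\to Y\to Z\to 0$ of $\mathfrak{g}$-modules, $Y\in\mathfrak{W}^{\mathfrak{g}}_{\mathfrak{n}}$ if and only if $X,Z\in \mathfrak{W}^{\mathfrak{g}}_{\mathfrak{n}}$).
   Context: Everything is over $\mathbb{C}$; Lie algebras may be infinite dimensional, and all vector spaces are assumed to have at most countable dimension. For a $\mathfrak{g}$-module $M$, the action of $\mathfrak{n}$ on $M$ is called locally finite if $\dim U(\mathfrak{n})v<\infty$ for every $v\in M$, where $U(\mathfrak n)$ is the universal enveloping algebra. $\mathfrak{W}^{\mathfrak{g}}_{\mathfrak{n}}$ denotes the full subcategory of $\mathfrak{g}\text{-}\mathrm{Mod}$ consisting of all $\mathfrak{g}$-modules on which the action of $\mathfrak{n}$ is locally finite. *)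

(* Defs.v *)
From HB Require Import structures.
From mathcomp Require Import all_boot all_algebra.
From mathcomp Require Import finmap monalg.
From mathcomp Require Import boolp classical_sets functions cardinality.

Set Implicit Arguments.
Unset Strict Implicit.
Unset Printing Implicit Defensive.

Import GRing.Theory.
Local Open Scope ring_scope.
Local Open Scope quotient_scope.
Local Open Scope classical_set_scope.

Section Dimension.
Variables (K : fieldType) (V : lmodType K).
Implicit Types B S : set V.

Definition lin_indep B := forall (s : seq V) (c : V -> K),
  uniq s -> [set` s] `<=` B ->
  \sum_(x <- s) c x *: x = 0 -> {in s, forall x, c x = 0}.

Definition spans B S := forall v, S v ->
  exists (s : seq V) (c : V -> K),
    [set` s] `<=` B /\ v = \sum_(x <- s) c x *: x.

(* Only meaningful when S is a linear subspace. *)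
Definition hamel_basis S B := [/\ B `<=` S, lin_indep B & spans B S].

Definition fin_dim S := exists2 B, finite_set B & hamel_basis S B.

Definition countable_dim S := exists2 B, countable B & hamel_basis S B.

End Dimension.

HB.mixin Record isLieAlgebra (K : fieldType) L of GRing.Lmodule K L := {
  lie : L -> L -> L;
  lie_linearl : forall y, linear (lie^~ y);
  lie_linearr : forall x, linear (lie x);
  liexx : forall x, lie x x = 0;
  lie_jacobi : forall x y z,
    lie x (lie y z) + lie y (lie z x) + lie z (lie x y) = 0
}.

#[short(type="lieAlgType")]
HB.structure Definition LieAlgebra (K : fieldType) :=
  {L of isLieAlgebra K L & GRing.Lmodule K L}.

HB.mixin Record isLieClosed (K : fieldType) (L : lieAlgType K)
    (n : {pred L}) := {
  lie_closed : forall x y, x \in n -> y \in n -> lie x y \in n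
}.

#[short(type="lieSubalg")]
HB.structure Definition LieSubalgebra (K : fieldType) (L : lieAlgType K) :=
  {n of isLieClosed K L n & GRing.isScaleClosed K L n & GRing.isAddClosed L n}.

Section SubLieAlgebra.
Variables (K : fieldType) (L : lieAlgType K) (n : lieSubalg L).

Record lie_sub : predArgType :=
  LieSub { lie_sub_val : L; lie_sub_valP : lie_sub_val \in n }.

HB.instance Definition _ := [isSub for lie_sub_val].
HB.instance Definition _ := [Choice of lie_sub by <:].
HB.instance Definition _ := [SubChoice_isSubLmodule of lie_sub by <:].

Definition lie_sub_lie (x y : lie_sub) : lie_sub :=
  LieSub (lie_closed _ _ (lie_sub_valP x) (lie_sub_valP y)).

Fact lie_sub_linearl y : linear (lie_sub_lie^~ y).
Proof. by move=> a u v; apply/val_inj; rewrite /= !(linearP, lie_linearl). Qed.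

Fact lie_sub_linearr x : linear (lie_sub_lie x).
Proof. by move=> a u v; apply/val_inj; rewrite /= !(linearP, lie_linearr). Qed.

Fact lie_sub_liexx x : lie_sub_lie x x = 0.
Proof. apply/val_inj; exact: liexx. Qed.

Fact lie_sub_jacobi x y z :
  lie_sub_lie x (lie_sub_lie y z) + lie_sub_lie y (lie_sub_lie z x)
    + lie_sub_lie z (lie_sub_lie x y) = 0.
Proof. apply/val_inj; exact: lie_jacobi. Qed.

HB.instance Definition _ := isLieAlgebra.Build K lie_sub
  lie_sub_linearl lie_sub_linearr lie_sub_liexx lie_sub_jacobi.

End SubLieAlgebra.

HB.mixin Record isLieModule (K : fieldType) (L : lieAlgType K) M
    of GRing.Lmodule K M := {
  lact : L -> M -> M;
  lact_linearl : forall v, linear (lact^~ v);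
  lact_linearr : forall x, linear (lact x);
  lact_lie : forall x y v, lact (lie x y) v = lact x (lact y v) - lact y (lact x v)
}.

#[short(type="lieModType")]
HB.structure Definition LieModule (K : fieldType) (L : lieAlgType K) :=
  {M of isLieModule K L M & GRing.Lmodule K M}.

Definition lie_res (K : fieldType) (L : lieAlgType K) (n : lieSubalg L)
  (M : Type) : Type := M.

Section Restriction.
Variables (K : fieldType) (L : lieAlgType K) (n : lieSubalg L).
Variable M : lieModType L.

HB.instance Definition _ := GRing.Lmodule.copy (lie_res n M) M.

Definition res_lact (x : lie_sub n) (v : lie_res n M) : lie_res n M :=
  lact (val x) (v : M).

Fact res_lact_linearl v : linear (res_lact^~ v).
Proof. by move=> a x y; rewrite /res_lact linearP lact_linearl. Qed.

Fact res_lact_linearr x : linear (res_lact x).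
Proof. by move=> a u v; rewrite /res_lact lact_linearr. Qed.

Fact res_lact_lie x y v :
  res_lact (lie x y) v = res_lact x (res_lact y v) - res_lact y (res_lact x v).
Proof. exact: lact_lie. Qed.

HB.instance Definition _ := isLieModule.Build K (lie_sub n) (lie_res n M)
  res_lact_linearl res_lact_linearr res_lact_lie.

End Restriction.

(* U(L) is the free unital associative algebra K<L> on the underlying set of L *)
(* (words in L with coefficients in K), modulo the two-sided ideal generated   *)
(* by the relators below. The first kind of relators makes L -> U(L) linear,   *)
(* so that the quotient by these alone is the tensor algebra T(L).             *)
Section EnvelopingAlgebra.
Variables (K : fieldType) (L : lieAlgType K).

Definition lie_free := {malg K[{fmonom L}]}.
HB.instance Definition _ := GRing.Lalgebra.on lie_free.

Definition free_gen (x : L) : lie_free := mkmalgU (fmu x) 1.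

Variant uea_relator : set lie_free :=
| UeaLinear a x y :
    uea_relator (free_gen (a *: x + y) - (a *: free_gen x + free_gen y))
| UeaLie x y :
    uea_relator (free_gen x * free_gen y - free_gen y * free_gen x
                 - free_gen (lie x y)).

Record two_sided_ideal (J : set lie_free) : Prop := TwoSidedIdeal {
  ideal0 : J 0;
  idealB : forall s t, J s -> J t -> J (s - t);
  idealMl : forall s t, J t -> J (s * t);
  idealMr : forall s t, J t -> J (t * s)
}.

Definition uea_ideal : {pred lie_free} := fun t =>
  `[< forall J, two_sided_ideal J -> uea_relator `<=` J -> J t >].

Lemma uea_idealP t : reflect
  (forall J, two_sided_ideal J -> uea_relator `<=` J -> J t) (t \in uea_ideal).
Proof. exact: asboolP. Qed.

Fact uea_ideal_zmod : zmod_closed uea_ideal.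
Proof.
split=> [|s t /uea_idealP Is /uea_idealP It]; apply/uea_idealP => J idJ rJ.
  exact: (ideal0 idJ).
by apply: (idealB idJ); [exact: Is | exact: It].
Qed.

HB.instance Definition _ := GRing.isZmodClosed.Build lie_free uea_ideal
  uea_ideal_zmod.

Lemma uea_idealMl s t : t \in uea_ideal -> s * t \in uea_ideal.
Proof.
by move=> /uea_idealP It; apply/uea_idealP => J iJ rJ; apply: (idealMl iJ); apply: It.
Qed.

Lemma uea_idealMr s t : t \in uea_ideal -> t * s \in uea_ideal.
Proof.
by move=> /uea_idealP It; apply/uea_idealP => J iJ rJ; apply: (idealMr iJ); apply: It.
Qed.

Lemma uea_relatorP t : uea_relator t -> t \in uea_ideal.
Proof. by move=> rt; apply/uea_idealP => J _; apply. Qed.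

(* The augmentation (the coefficient of the empty word) kills the ideal. *)
Lemma uea_ideal1 : (1 : lie_free) \notin uea_ideal.
Proof.
apply/negP => /uea_idealP /(_ [set t | mcoeff (@mone {fmonom L}) t = 0]) /=.
rewrite rmorph1 => I1; suff: (1 : K) = 0 by apply/eqP; rewrite oner_eq0.
have gen0 x : mcoeff (@mone {fmonom L}) (free_gen x) = 0.
  by rewrite /free_gen mcoeffU fm1_eq1.
apply: I1; first split=> /=.
- by rewrite mcoeff0.
- by move=> s t s0 t0; rewrite mcoeffB s0 t0 subr0.
- by move=> s t t0; rewrite rmorphM /= t0 mulr0.
- by move=> s t t0; rewrite rmorphM /= t0 mul0r.
move=> _ [a x y|x y] /=.
  by rewrite mcoeffB mcoeffD mcoeffZ !gen0 mulr0 addr0 subr0.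
by rewrite !mcoeffB !rmorphM /= !gen0 mulr0 !subr0.
Qed.

Definition uea := Quotient.quot uea_ideal.
HB.instance Definition _ := GRing.Zmodule.on uea.
HB.instance Definition _ := Quotient.on uea.

Definition uea_pi (t : lie_free) : uea := \pi_uea t.

Lemma uea_pi_eq s t : (uea_pi s = uea_pi t) <-> (s - t \in uea_ideal).
Proof. rewrite Quotient.idealrBE; exact: rwP eqP. Qed.

Lemma uea_piK u : uea_pi (repr u) = u.
Proof. exact: reprK. Qed.

Lemma ueaP u : exists t, u = uea_pi t.
Proof. by exists (repr u); rewrite uea_piK. Qed.

Lemma uea_piB s t : uea_pi (s - t) = uea_pi s - uea_pi t.
Proof. by rewrite /uea_pi !piE. Qed.

Lemma uea_piD s t : uea_pi (s + t) = uea_pi s + uea_pi t.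
Proof. by rewrite /uea_pi !piE. Qed.

Definition uea_one : uea := uea_pi 1.
Definition uea_mul (u v : uea) : uea := uea_pi (repr u * repr v).
Definition uea_scale (a : K) (u : uea) : uea := uea_pi (a *: repr u).

Lemma repr_uea_pi t : repr (uea_pi t) - t \in uea_ideal.
Proof. by apply/uea_pi_eq; rewrite uea_piK. Qed.

Lemma uea_pi_mul s t : uea_pi (s * t) = uea_mul (uea_pi s) (uea_pi t).
Proof.
apply/esym/uea_pi_eq; set s' := repr _; set t' := repr _.
rewrite -[X in X - _](addrNK (s' * t)) -mulrBr -addrA -mulrBl rpredD //.
  exact/uea_idealMl/repr_uea_pi.
exact/uea_idealMr/repr_uea_pi.
Qed.

Lemma uea_pi_scale a t : uea_pi (a *: t) = uea_scale a (uea_pi t).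
Proof.
apply/esym/uea_pi_eq; rewrite -scalerBr -[_ - t]mul1r scalerAl.
exact/uea_idealMl/repr_uea_pi.
Qed.

Fact uea_mulA : associative uea_mul.
Proof.
move=> u v w; case: (ueaP u) (ueaP v) (ueaP w) => r -> [s ->] [t ->].
by rewrite -(uea_pi_mul s t) -(uea_pi_mul r s) -!uea_pi_mul mulrA.
Qed.

Fact uea_mul1 : left_id uea_one uea_mul.
Proof. by move=> u; case: (ueaP u) => t ->; rewrite -uea_pi_mul mul1r. Qed.

Fact uea_mulr1 : right_id uea_one uea_mul.
Proof. by move=> u; case: (ueaP u) => t ->; rewrite -uea_pi_mul mulr1. Qed.

Fact uea_mulDl : left_distributive uea_mul +%R.
Proof.
move=> u v w; case: (ueaP u) (ueaP v) (ueaP w) => r -> [s ->] [t ->].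
by rewrite -(uea_pi_mul r t) -(uea_pi_mul s t) -!uea_piD -uea_pi_mul mulrDl.
Qed.

Fact uea_mulDr : right_distributive uea_mul +%R.
Proof.
move=> u v w; case: (ueaP u) (ueaP v) (ueaP w) => r -> [s ->] [t ->].
by rewrite -(uea_pi_mul r s) -(uea_pi_mul r t) -!uea_piD -uea_pi_mul mulrDr.
Qed.

Fact uea_oner_neq0 : uea_one != 0.
Proof.
rewrite -(subrr (uea_pi 0)) -uea_piB subrr; apply/eqP => /uea_pi_eq.
by rewrite subr0 (negbTE uea_ideal1).
Qed.

HB.instance Definition _ := GRing.Zmodule_isNzRing.Build uea
  uea_mulA uea_mul1 uea_mulr1 uea_mulDl uea_mulDr uea_oner_neq0.

Fact uea_scaleA a b u : uea_scale a (uea_scale b u) = uea_scale (a * b) u.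
Proof.
by case: (ueaP u) => t ->; rewrite -(uea_pi_scale b) -!uea_pi_scale scalerA.
 Qed.

Fact uea_scale1 : left_id 1 uea_scale.
Proof. by move=> u; case: (ueaP u) => t ->; rewrite -uea_pi_scale scale1r. Qed.

Fact uea_scaleDr : right_distributive uea_scale +%R.
Proof.
move=> a u v; case: (ueaP u) (ueaP v) => s -> [t ->].
by rewrite -uea_piD -!uea_pi_scale -uea_piD scalerDr.
Qed.

Fact uea_scaleDl u : {morph uea_scale^~ u : a b / a + b}.
Proof.
by move=> a b; case: (ueaP u) => t ->; rewrite -!uea_pi_scale -uea_piD scalerDl.
Qed.

HB.instance Definition _ := GRing.Zmodule_isLmodule.Build K uea
  uea_scaleA uea_scale1 uea_scaleDr uea_scaleDl.

Fact uea_scaleAl (a : K) (u v : uea) : a *: (u * v) = (a *: u) * v.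
Proof.
case: (ueaP u) (ueaP v) => s -> [t ->].
have mulE x y : uea_pi x * uea_pi y = uea_pi (x * y) by rewrite uea_pi_mul.
have scaleE x : a *: uea_pi x = uea_pi (a *: x) by rewrite uea_pi_scale.
by rewrite !(mulE, scaleE) scalerAl.
Qed.

HB.instance Definition _ := GRing.Lmodule_isLalgebra.Build K uea uea_scaleAl.

Lemma lie_free_scaleAr (a : K) (s t : lie_free) : a *: (s * t) = s * (a *: t).
Proof.
apply/malgP => w; rewrite mcoeffZ mcoeffMl.
rewrite (mcoeffMlw w (fsubset_refl _) (msuppZ_le a t)) mulr_sumr.
apply: eq_bigr => k1 _; rewrite mulr_sumr; apply: eq_bigr => k2 _.
by rewrite mcoeffZ mulrnAr mulrCA.
Qed.

Fact uea_scaleAr (a : K) (u v : uea) : a *: (u * v) = u * (a *: v).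
Proof.
case: (ueaP u) (ueaP v) => s -> [t ->].
have mulE x y : uea_pi x * uea_pi y = uea_pi (x * y) by rewrite uea_pi_mul.
have scaleE x : a *: uea_pi x = uea_pi (a *: x) by rewrite uea_pi_scale.
by rewrite !(mulE, scaleE) lie_free_scaleAr.
Qed.

HB.instance Definition _ := GRing.Lalgebra_isAlgebra.Build K uea uea_scaleAr.

Fact uea_pi_linear : linear uea_pi.
Proof. by move=> a s t; rewrite uea_piD uea_pi_scale. Qed.

HB.instance Definition _ := GRing.isLinear.Build K lie_free uea _ uea_pi
  uea_pi_linear.

Fact uea_pi_monoid_morphism : monoid_morphism uea_pi.
Proof. by split=> // s t; rewrite uea_pi_mul. Qed.

HB.instance Definition _ := GRing.isMonoidMorphism.Build lie_free uea uea_pi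
  uea_pi_monoid_morphism.

Definition uea_gen (x : L) : uea := uea_pi (free_gen x).

Fact uea_gen_linear : linear uea_gen.
Proof.
move=> a x y; rewrite /uea_gen -linearP; apply/uea_pi_eq.
exact/uea_relatorP/UeaLinear.
Qed.

HB.instance Definition _ := GRing.isLinear.Build K L uea _ uea_gen
  uea_gen_linear.

Lemma uea_gen_lie x y :
  uea_gen (lie x y) = uea_gen x * uea_gen y - uea_gen y * uea_gen x.
Proof.
rewrite /uea_gen -!rmorphM -rmorphB; apply/esym/uea_pi_eq.
exact/uea_relatorP/UeaLie.
Qed.

End EnvelopingAlgebra.

Section EnvelopingAction.
Variables (K : fieldType) (L : lieAlgType K) (M : lieModType L).

(* The word [:: x1; ...; xk] acts by v |-> x1 (x2 (... (xk v))). *)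
Definition word_act (w : {fmonom L}) (v : M) : M :=
  foldr (fun x u => lact x u) v w.

Definition free_act (t : lie_free L) (v : M) : M :=
  \sum_(w <- msupp t) mcoeff w t *: word_act w v.

Definition uea_act (u : uea L) (v : M) : M := free_act (repr u) v.

Lemma word_act_linear w : linear (word_act w).
Proof.
rewrite /word_act; case: w => w /=; elim: w => //= x w IH a u v.
by rewrite IH lact_linearr.
Qed.

HB.instance Definition _ w := GRing.isLinear.Build K M M _ (word_act w)
  (word_act_linear w).

Lemma word_actM w1 w2 v : word_act (mmul w1 w2) v = word_act w1 (word_act w2 v).
Proof. by rewrite /word_act fmM foldr_cat. Qed.

Lemma free_actEw (d : {fset {fmonom L}}) t v : (msupp t `<=` d)%fset ->
  free_act t v = \sum_(w <- d) mcoeff w t *: word_act w v.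
Proof.
move=> le; rewrite /free_act (big_fset_incl _ le) //= => w _ /mcoeff_outdom ->.
by rewrite scale0r.
Qed.

Lemma free_act_linearl v : linear (free_act^~ v).
Proof.
move=> a s t; pose d := (msupp s `|` msupp t `|` msupp (a *: s + t))%fset.
rewrite !(@free_actEw d); first last.
- by rewrite /d fsubsetUr.
- by rewrite /d -fsetUA fsubsetUl.
- by rewrite /d fsetUAC fsubsetUr.
rewrite scaler_sumr -big_split; apply: eq_bigr => w _ /=.
by rewrite mcoeffD mcoeffZ scalerDl scalerA.
Qed.

Lemma free_act_linearr t : linear (free_act t).
Proof.
move=> a u v; rewrite /free_act scaler_sumr -big_split; apply: eq_bigr => w _ /=.
by rewrite linearP scalerDr !scalerA mulrC.
Qed.

HB.instance Definition _ t := GRing.isLinear.Build K M M _ (free_act t)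
  (free_act_linearr t).

Definition free_act_on (v : M) (t : lie_free L) : M := free_act t v.
HB.instance Definition _ v := GRing.isLinear.Build K (lie_free L) M _
  (free_act_on v) (free_act_linearl v).

Lemma free_actU c w v : free_act (mkmalgU w c) v = c *: word_act w v.
Proof. by rewrite (free_actEw _ msuppU_le) big_seq_fset1 mcoeffUU. Qed.

Lemma free_act1 v : free_act 1 v = v.
Proof. by rewrite [1]/(mkmalgU _ _) free_actU scale1r /word_act fm1. Qed.

Lemma free_actM s t v : free_act (s * t) v = free_act s (free_act t v).
Proof.
rewrite malgME -/(free_act_on v _) linear_sum [RHS]/free_act.
apply: eq_bigr => w1 _; rewrite linear_sum.
rewrite [in RHS]/free_act linear_sum scaler_sumr; apply: eq_bigr => w2 _ /=.
by rewrite /free_act_on free_actU word_actM linearZ /= scalerA.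
Qed.

Lemma free_act_gen x v : free_act (free_gen x) v = lact x v.
Proof. by rewrite free_actU scale1r /word_act fmU. Qed.

Lemma free_act_ideal t v : t \in @uea_ideal K L -> free_act t v = 0.
Proof.
move=> /uea_idealP It.
apply: (It [set t | forall u, free_act t u = 0]) => {It} /=.
  split=> [u|r s r0 s0 u|r s s0 u|r s s0 u] /=.
  - exact: (linear0 (free_act_on u)).
  - by rewrite -/(free_act_on u _) linearB /= /free_act_on r0 s0 subr0.
  - by rewrite free_actM s0 linear0.
  - by rewrite free_actM s0.
move=> _ [a x y|x y] u; rewrite -/(free_act_on u _).
  rewrite linearB linearP /= /free_act_on !free_act_gen lact_linearl.
  by rewrite subrr.
by rewrite !linearB /= /free_act_on !free_actM !free_act_gen lact_lie subrr.
Qed.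

Lemma uea_act_pi t v : uea_act (uea_pi t) v = free_act t v.
Proof.
apply/eqP; rewrite -subr_eq0 /uea_act -!/(free_act_on v _) -linearB /=.
by rewrite /free_act_on free_act_ideal // repr_uea_pi.
Qed.

Lemma uea_act_linearl v : linear (uea_act^~ v).
Proof.
move=> a u1 u2; case: (ueaP u1) (ueaP u2) => s -> [t ->].
by rewrite -linearP !uea_act_pi free_act_linearl.
Qed.

Lemma uea_act_linearr u : linear (uea_act u).
Proof. exact: free_act_linearr. Qed.

Lemma uea_act1 v : uea_act 1 v = v.
Proof. by rewrite -(rmorph1 (@uea_pi K L)) uea_act_pi free_act1. Qed.

Lemma uea_actM u1 u2 v : uea_act (u1 * u2) v = uea_act u1 (uea_act u2 v).
Proof.
case: (ueaP u1) (ueaP u2) => s -> [t ->].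
by rewrite -rmorphM !uea_act_pi free_actM.
Qed.

Lemma uea_act_gen x v : uea_act (uea_gen x) v = lact x v.
Proof. by rewrite uea_act_pi free_act_gen. Qed.

Definition locally_finite : Prop :=
  forall v : M, fin_dim (range (uea_act^~ v)).

End EnvelopingAction.

Section ModuleCategory.
Variables (K : fieldType) (L : lieAlgType K).

(* The objects of L-Mod: by convention all vector spaces have at most countable *)
(* dimension.                                                                   *)
Record lieMod := LieMod {
  lieMod_sort :> lieModType L;
  lieMod_countable : countable_dim [set: lieMod_sort]
}.

Definition lie_equivariant (X Y : lieModType L) (f : X -> Y) :=
  forall x v, f (lact x v) = lact x (f v).

Definition short_exact (X Y Z : lieModType L)
    (f : {linear X -> Y}) (h : {linear Y -> Z}) :=
  [/\ injective f, range f = [set y | h y = 0] & range h = [set: Z]].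

(* A full subcategory is given by its class P of objects. *)
Definition serre_subcategory (P : lieMod -> Prop) :=
  forall (X Y Z : lieMod) (f : {linear X -> Y}) (h : {linear Y -> Z}),
    lie_equivariant f -> lie_equivariant h -> short_exact f h ->
    P Y <-> P X /\ P Z.

Definition whittaker_cat (n : lieSubalg L) : lieMod -> Prop :=
  fun M => locally_finite (lie_res n M).

End ModuleCategory.

(* Main.v *)
(* For an extension of Z by X, let v be a vector of Y and lift a finite basis  *)
(* of U(n)h(v) to a finite family s in Y. The vector v and each of the         *)
(* finitely many vectors x y, with x in a basis of n and y in s, lie in        *)
(* span s + f(k) for some k in X. Then span s + f(sum of the U(n)k) is finite  *)
(* dimensional, n-stable and contains v. This replaces the usual appeal to the *)
(* Noetherianity of U(n).                                                      *)
Require Import Defs.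
From HB Require Import structures.
From mathcomp Require Import all_boot all_algebra.
From mathcomp Require Import complex.
From mathcomp Require Import boolp classical_sets functions cardinality reals.

Set Implicit Arguments.
Unset Strict Implicit.
Unset Printing Implicit Defensive.

Import GRing.Theory.
Local Open Scope ring_scope.
Local Open Scope classical_set_scope.

(** The orbit U(n)v is the least [n]-stable subspace containing v, so a module is locally finite
    exactly when each vector lies in a finitely spanned stable subspace ([locally_finiteP]).
    Equivariant maps carry orbits onto orbits ([image_orbit]): an orbit in a submodule embeds into
    an orbit of the big module, and an orbit in a quotient is the image of one. For extensions
    ([locally_finite_extension]), finite dimension of [n] turns stability of a finite span into
    finitely many conditions; the corrections from X that they require lie together in one finitely
    spanned stable subspace ([locally_finite_seq]). *)

Section FiniteSpan.
Variables (K : fieldType) (V : lmodType K).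
Implicit Types (s t : seq V) (S T : set V).

(** * Subspaces and finite spans *)

Definition subspace S := S 0 /\ forall a u v, S u -> S v -> S (a *: u + v).

Lemma subspaceZ S a u : subspace S -> S u -> S (a *: u).
Proof. by move=> [S0 SP] Su; rewrite -[_ *: _]addr0; exact: SP. Qed.

Lemma subspaceD S u v : subspace S -> S u -> S v -> S (u + v).
Proof. by move=> [S0 SP] Su Sv; rewrite -[u]scale1r; exact: SP. Qed.

Lemma subspaceB S u v : subspace S -> S u -> S v -> S (u - v).
Proof. by move=> [S0 SP] Su Sv; rewrite addrC -scaleN1r; exact: SP. Qed.

Lemma subspace_sum S s (c : V -> K) : subspace S -> [set` s] `<=` S ->
  S (\sum_(x <- s) c x *: x).
Proof.
move=> subS sS; rewrite big_seq; elim/big_ind: _ => [|u v|x /sS Sx].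
- by case: subS.
- exact: subspaceD.
- exact: subspaceZ.
Qed.

(** Peeling off one coefficient per entry suits induction on the list and allows repeated entries,
    unlike a coefficient function on a duplicate-free list. *)
Fixpoint in_span s : set V :=
  if s is x :: s' then [set v | exists a, in_span s' (v - a *: x)]
  else [set 0].

Lemma in_span_subspace s : subspace (in_span s).
Proof.
elim: s => [|x s [IH0 IH]] /=; split=> //.
- by move=> a u v -> ->; rewrite scaler0 addr0.
- by exists 0; rewrite scale0r subr0.
move=> a u v [b ub] [c vc]; exists (a * b + c).
have -> : a *: u + v - (a * b + c) *: x = a *: (u - b *: x) + (v - c *: x).
  by rewrite scalerDl scalerBr scalerA opprD addrACA.
exact: IH.
Qed.

Lemma in_span_mem s : [set` s] `<=` in_span s.
Proof.
elim: s => [|x s IH] y //=; rewrite inE => /predU1P[->|ys].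
  by exists 1; rewrite scale1r subrr; case: (in_span_subspace s).
by exists 0; rewrite scale0r subr0; apply: IH.
Qed.

Lemma in_span_min s S : subspace S -> [set` s] `<=` S -> in_span s `<=` S.
Proof.
move=> subS; elim: s => [|x s IH] sS v /=; first by move=> ->; case: subS.
move=> [a va]; rewrite -[v](subrK (a *: x)); apply: subspaceD => //.
  by apply: IH va => y /= ys; apply: sS; rewrite /= inE ys orbT.
by apply: subspaceZ => //; apply: sS; rewrite /= mem_head.
Qed.

Lemma in_spanS s t : {subset s <= t} -> in_span s `<=` in_span t.
Proof.
move=> st; apply: in_span_min; first exact: in_span_subspace.
by move=> x /= /st; exact: in_span_mem.
Qed.

Lemma fin_dim_in_span S : fin_dim S ->
  exists2 s, [set` s] `<=` S & S `<=` in_span s.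
Proof.
move=> [B /finite_seqP[s ->] [sS _ spanS]]; exists s => // v /spanS[r [c [rs ->]]].
by apply: subspace_sum; [exact: in_span_subspace | move=> x /rs/in_span_mem].
Qed.

(** Induction on [s]: if [S] is not inside the span of the tail, any [y] in [S] outside that span
    completes a basis of the intersection of [S] with it. *)
Lemma in_span_fin_dim s S : subspace S -> S `<=` in_span s -> fin_dim S.
Proof.
elim: s S => [|x s IH] S subS Ss.
  exists set0; first exact: finite_set0.
  split=> //; first by move=> [|y r] c _ // /(_ y (mem_head _ _)).
  by move=> v /Ss/= ->; exists [::], (fun=> 0); rewrite big_nil.
have [|] := pselect (S `<=` in_span s); first exact: IH.
move=> /existsNP[y /not_implyP[Sy sNy]].
have subs := in_span_subspace s.
have [S0 SP] := subS; have [s0 sP] := subs.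
have [||B finB [BS freeB spanB]] := IH (S `&` in_span s).
- by split=> // a u v [Su su] [Sv sv]; split; [exact: SP | exact: sP].
- by move=> ? [].
exists (y |` B); first by rewrite finite_setU; split.
have BNy z : B z -> z != y.
  by move=> /BS[_ sz]; apply/eqP => zy; apply: sNy; rewrite -zy.
split=> [z [->|/BS[]]//|r c Ur rB|v Sv].
- have [yr|yNr] := boolP (y \in r); last first.
    apply: freeB => // z zr; case: (rB z zr) => // zy.
    by rewrite -zy (zr : z \in r) in yNr.
  have remB : [set` rem y r] `<=` B.
    move=> z /=; rewrite mem_rem_uniq // inE => /andP[/= zNy zr].
    by case: (rB z zr) => // zy; rewrite zy eqxx in zNy.
  rewrite (perm_big _ (perm_to_rem yr)) big_cons => sum0.
  (* Otherwise dividing the relation by [c y] would put [y] in the span of the tail. *)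
  have cy0 : c y = 0.
    apply/eqP/negP => /negP cy0; apply: sNy.
    rewrite -[y]scale1r -(mulVf cy0) -scalerA.
    have /eqP := sum0; rewrite addr_eq0 => /eqP ->.
    apply: subspaceZ => //.
    rewrite -sub0r; apply: subspaceB => //.
    by apply: subspace_sum => //; move=> z /remB/BS[].
  move: sum0; rewrite /= cy0 scale0r add0r => /(freeB _ _ (rem_uniq _ Ur) remB) c0.
  move=> z zr; have [->//|zNy] := eqVneq z y.
  by apply: c0; rewrite mem_rem_uniq // inE zr andbT.
- have [a ya] := Ss y Sy; have [b vb] := Ss v Sv.
  have a0 : a != 0.
    by apply/eqP => a0; apply: sNy; move: ya; rewrite a0 scale0r subr0.
  (* The factor [b / a] makes the [x]-components of [v] and [y] cancel. *)
  have [|r [c [rB rE]]] := spanB (v - (b / a) *: y).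
    split; first by apply: subspaceB => //; apply: subspaceZ.
    have -> : v - (b / a) *: y = (v - b *: x) - (b / a) *: (y - a *: x).
      by rewrite scalerBr scalerA divfK // opprB addrA subrK.
    apply: subspaceB => //.
    exact: subspaceZ.
  (* [c] is arbitrary at [y], so it is overridden there; [y] is not in [r] because [B] lies in the
     span of the tail. *)
  exists (y :: r), (fun z => if z == y then b / a else c z); split.
    by move=> z /=; rewrite inE => /predU1P[->|/rB]; [left|right].
  rewrite big_cons eqxx [X in _ + X](_ : _ = v - (b / a) *: y).
    by rewrite addrC subrK.
  rewrite rE big_seq [RHS]big_seq; apply: eq_bigr => z zr.
  by rewrite (negPf (BNy z (rB z zr))).
Qed.

End FiniteSpan.

(** * Spans under linear maps *)

Section LinearImage.
Variables (K : fieldType) (V W : lmodType K) (f : {linear V -> W}).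

Lemma in_span_map s v : in_span s v -> in_span (map f s) (f v).
Proof.
elim: s v => [|x s IH] v /=; first by move=> ->; rewrite linear0.
by move=> [a /IH]; rewrite linearB linearZ; exists a.
Qed.

Lemma in_span_map_lift s v : in_span (map f s) (f v) ->
  exists2 k, f k = 0 & in_span s (v - k).
Proof.
elim: s v => [|x s IH] v /=; first by move=> fv0; exists v; rewrite ?subrr.
move=> [a]; rewrite -linearZ -linearB => /IH[k k0 vk]; exists k => //.
by exists a; rewrite addrAC.
Qed.

Lemma lift_seq (S : set V) t : [set` t] `<=` f @` S ->
  exists2 s, [set` s] `<=` S & map f s = t.
Proof.
elim: t => [|y t IH] tS; first by exists [::].
have [x Sx xy] := tS y (mem_head _ _).
have [|s sS st] := IH; first by move=> z zt; apply: tS; rewrite /= inE zt orbT.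
exists (x :: s); last by rewrite /= xy st.
by move=> z /=; rewrite inE => /predU1P[->|/sS].
Qed.

End LinearImage.

Lemma linear_at0 (K : fieldType) (V W : lmodType K) (f : V -> W) :
  linear f -> f 0 = 0.
Proof. by move=> fP; have := fP (-1) 0 0; rewrite !scaleN1r !addNr. Qed.

(** * Orbits, stable subspaces, submodules and quotients *)

Section Orbit.
Variables (K : fieldType) (L : lieAlgType K).
Implicit Types M : lieModType L.

Definition stable M (S : set M) := forall x v, S v -> S (lact x v).

Definition orbit M (v : M) := range (fun u => uea_act u v).

Lemma orbit_subspace M (v : M) : subspace (orbit v).
Proof.
split; first by exists 0 => //; exact: linear_at0 (@uea_act_linearl _ _ _ v).
by move=> a _ _ [x _ <-] [y _ <-]; exists (a *: x + y) => //; rewrite /= uea_act_linearl.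
Qed.

Lemma orbit_refl M (v : M) : orbit v v.
Proof. by exists 1 => //; exact: uea_act1. Qed.

Lemma orbit_stable M (v : M) : stable (orbit v).
Proof.
by move=> x _ [u _ <-]; exists (uea_gen x * u) => //; rewrite uea_actM uea_act_gen.
Qed.

(** An element of U(L) acts through a representative, as a linear combination of words, and each
    word acts by iterating [lact]. *)
Lemma orbit_min M (v : M) S : subspace S -> stable S -> S v -> orbit v `<=` S.
Proof.
move=> subS stS Sv _ [u _ <-]; rewrite /uea_act /free_act.
elim/big_ind: _ => [|x y|w _]; [by case: subS | exact: subspaceD |].
apply: subspaceZ => //; rewrite /word_act.
by case: w; elim=> //= x r IH; exact: stS.
Qed.

Lemma stable_in_span M (s : seq M) :
  (forall x y, y \in s -> in_span s (lact x y)) -> stable (in_span s).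
Proof.
move=> sP x; apply: (@in_span_min _ _ _ [set v | in_span s (lact x v)]).
  have [s0 ssP] := in_span_subspace s; split=> /=.
    by rewrite (linear_at0 (@lact_linearr _ _ _ x)).
  by move=> a u v su sv; rewrite /= lact_linearr; exact: ssP.
by move=> y; exact: sP.
Qed.

(** This form lets stable subspaces be built from explicit lists, without exhibiting a Hamel
    basis. *)
Lemma locally_finiteP M : locally_finite M <->
  forall v : M, exists2 s, stable (in_span s) & in_span s v.
Proof.
split=> [lfM v|lfM v]; last first.
  have [s sst sv] := lfM v.
  apply: (@in_span_fin_dim _ _ s); first exact: orbit_subspace.
  by apply: orbit_min => //; exact: in_span_subspace.
have [s so os] := fin_dim_in_span (lfM v).
exists s; last exact/os/orbit_refl.
by apply: stable_in_span => x y /so/(@orbit_stable _ _ x _)/os.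
Qed.

Variables (X Y : lieModType L) (f : {linear X -> Y}).
Hypothesis fE : lie_equivariant f.

Lemma image_orbit v : f @` orbit v = orbit (f v).
Proof.
suff fu u : f (uea_act u v) = uea_act u (f v).
  apply/seteqP; split=> [_ [_ [u _ <-] <-]|_ [u _ <-]].
    by exists u => //; rewrite fu.
  by exists (uea_act u v); rewrite ?fu//; exists u.
rewrite /uea_act /free_act linear_sum; apply: eq_bigr => w _; rewrite linearZ /=.
by congr (_ *: _); rewrite /word_act; case: w; elim=> //= x r <-.
Qed.

Lemma locally_finite_injective :
  injective f -> locally_finite Y -> locally_finite X.
Proof.
move=> finj lfY v; have [t to ot] := fin_dim_in_span (lfY (f v)).
have [|s so st] := @lift_seq _ _ _ f (orbit v) t; first by rewrite image_orbit.
apply: (@in_span_fin_dim _ _ s) => [|u vu]; first exact: orbit_subspace.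
have : in_span (map f s) (f u) by rewrite st; apply: ot; rewrite -/(orbit _) -image_orbit; exists u.
(* The lift is determined up to a kernel vector [k], which injectivity makes zero. *)
move=> /in_span_map_lift[k]; rewrite -(linear0 f) => /finj ->.
by rewrite subr0.
Qed.

Lemma locally_finite_surjective :
  range f = setT -> locally_finite X -> locally_finite Y.
Proof.
move=> fsurj lfX w; have [v _ <-] : range f w by rewrite fsurj.
have [s _ os] := fin_dim_in_span (lfX v).
apply: (@in_span_fin_dim _ _ (map f s)); first exact: orbit_subspace.
by rewrite -/(orbit _) -image_orbit => _ [u /os su <-]; exact: in_span_map.
Qed.

End Orbit.

Lemma locally_finite_seq (K : fieldType) (L : lieAlgType K) (M : lieModType L)
    (s : seq M) : locally_finite M ->
  exists2 q, stable (in_span q) & {subset s <= in_span q}.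
Proof.
move=> /locally_finiteP lfM; elim: s => [|v s [q stq sq]].
  by exists [::] => // x u ->; rewrite (linear_at0 (@lact_linearr _ _ _ x)).
have [r str rv] := lfM v; exists (r ++ q).
  apply: stable_in_span => x y; rewrite mem_cat => /orP[yr|yq].
    apply: (@in_spanS _ _ r); first by move=> z zr; rewrite mem_cat zr.
    exact/str/in_span_mem.
  apply: (@in_spanS _ _ q); first by move=> z zq; rewrite mem_cat zq orbT.
  exact/stq/in_span_mem.
move=> y; rewrite inE => /predU1P[->|/sq].
  by apply/mem_set/(@in_spanS _ _ r) => // z zr; rewrite mem_cat zr.
move=> /set_mem yq; apply/mem_set/(@in_spanS _ _ q) => // z zq.
by rewrite mem_cat zq orbT.
Qed.

(** * Extensions of locally finite modules *)

Section Extension.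
Variables (K : fieldType) (L : lieAlgType K) (t : seq L).
Hypothesis tL : forall x, in_span t x.
Variables (X Y Z : lieModType L) (f : {linear X -> Y}) (h : {linear Y -> Z}).
Hypotheses (fE : lie_equivariant f) (hE : lie_equivariant h).
Hypothesis fh : range f = [set y | h y = 0].

Lemma locally_finite_extension :
  locally_finite X -> locally_finite Z -> locally_finite Y.
Proof.
move=> lfX lfZ; apply/locally_finiteP => v.
have [r ro or] := fin_dim_in_span (lfZ (h v)).
have [|s so sr] := @lift_seq _ _ _ h (orbit v) r; first by rewrite image_orbit.
pose W := v :: [seq lact x y | x <- t, y <- s].
have [k kP] : exists k, {in W, forall w, in_span s (w - f (k w))}.
  suff /choice[k kP] : forall w, exists k, w \in W -> in_span s (w - f k).
    by exists k => w; exact: kP.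
  (* Choice needs a total function, hence the default 0 outside [W]. *)
  move=> w; have [wW|] := boolP (w \in W); last by exists 0.
  have : in_span (map h s) (h w).
    rewrite sr; apply: or; rewrite -/(orbit _) -image_orbit//; exists w => //.
    move: wW; rewrite inE => /predU1P[->|]; first exact: orbit_refl.
    by case/allpairsP => -[x y] [/= _ /so + ->]; exact: orbit_stable.
  move=> /in_span_map_lift[y y0 sy].
  by have [k _ ky] : range f y by [rewrite fh]; exists k; rewrite ky.
have [q stq qk] := locally_finite_seq (map k W) lfX.
pose T := s ++ map f q.
have sT : in_span s `<=` in_span T by apply: in_spanS => z zs; rewrite mem_cat zs.
have fT u : in_span q u -> in_span T (f u).
  move=> /(in_span_map f); apply: in_spanS => z zq.
  by rewrite mem_cat zq orbT.
have WT w : w \in W -> in_span T w.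
  move=> wW; rewrite -[w](subrK (f (k w))).
  apply: subspaceD; [exact: in_span_subspace | exact/sT/kP |].
  by apply/fT/set_mem/qk/map_f.
exists T; last exact/WT/mem_head.
apply: stable_in_span => x y; rewrite mem_cat => /orP[ys|/mapP[u uq ->]].
  (* By linearity in the Lie algebra variable it suffices to act by the entries of [t], and those
     products were put in [W]. *)
  suff : in_span t `<=` [set z | in_span T (lact z y)] by apply.
  have [T0 TP] := in_span_subspace T.
  apply: in_span_min; first split=> /= [|a u1 u2 Tu1 Tu2].
  - by rewrite (linear_at0 (@lact_linearl _ _ _ y)).
  - by rewrite lact_linearl; exact: TP.
  - by move=> z zt; apply/WT; rewrite inE allpairs_f ?orbT.
by rewrite -fE; apply/fT/stq/in_span_mem.
Qed.

End Extension.

(** Moves finite dimension from a subset of [g] to the type [lie_sub n]: the inclusion [val] has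
    zero kernel, so spanning relations lift along it. *)
Lemma in_span_lie_sub (K : fieldType) (g : lieAlgType K) (n : lieSubalg g) :
  fin_dim [set x : g | x \in n] ->
  exists t : seq (lie_sub n), forall x, in_span t x.
Proof.
move=> /fin_dim_in_span[s sn ns]; exists (pmap insub s) => x.
have := ns _ (valP x); rewrite -{1}(_ : map val (pmap insub s : seq (lie_sub n)) = s).
  by move=> /in_span_map_lift[k k0]; rewrite (_ : k = 0) ?subr0//; exact: val_inj.
rewrite pmap_filter; last exact: insubK.
by apply/all_filterP/allP => y /sn; rewrite /= isSome_insub.
Qed.

(* R[i] is the field of complex numbers. *)
Theorem proposition1 (R : realType) (g : lieAlgType R[i]) (n : lieSubalg g)
    (g_countable : countable_dim [set: g])
    (g_nonzero : exists x : g, x != 0)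
    (n_fin_dim : fin_dim [set x : g | x \in n]) :
  serre_subcategory (whittaker_cat n).
Proof.
have [t tn] := in_span_lie_sub n_fin_dim.
move=> X Y Z f h fE hE [finj fh hsurj]; rewrite /whittaker_cat.
(* [lie_res n X] has the same vectors and linear structure as [X], so the maps are merely retyped;
   only the acting algebra changes. *)
pose f' : {linear lie_res n X -> lie_res n Y} := f.
pose h' : {linear lie_res n Y -> lie_res n Z} := h.
have f'E : lie_equivariant f' by move=> x v; exact: fE.
have h'E : lie_equivariant h' by move=> x v; exact: hE.
split=> [lfY|[lfX lfZ]]; last exact: (locally_finite_extension tn f'E h'E fh).
split; first exact: (locally_finite_injective f'E finj).
exact: (locally_finite_surjective h'E hsurj).
Qed.
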